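(* Let $g:\mathbb{R}^n\to\mathbb{R}\cup\{+\infty\}$ be proper, lower semicontinuous and convex; let $f:\mathbb{R}^n\to\mathbb{R}$ be twice differentiable and $\mu$-strongly convex, with $L$-Lipschitz gradient and $L_H$-Lipschitz Hessian ($\mu,L,L_H>0$); and suppose that $F:=g+f$ is bounded from below. For any initialization $x_0\in\mathbb{R}^n$ and any $N\in\mathbb{N}$, the algorithm Cubic SR1 PQN (defined in the context) has a global convergence with the rate $$\|F'(x_N)\|\le\left(\frac{C}{N^{1/2}}\right)^{N/2}\|F'(x_0)\|,$$ where $C:=\left(2nL_HC_0+nL\right)/\mu$ and $C_0:=\sqrt{\frac{2(F(x_0)-\inf F)}{\mu}}$.
   Context: Conventions. $\|\cdot\|$ is the Euclidean norm on $\mathbb{R}^n$ and the induced operator norm on matrices; the Lipschitz property of $\nabla^2 f$ is with respect to these norms. $\|x\|_M^2:=x^\top Mx$; $I$ is the identity matrix; $\partial$ is the convex subdifferential; $A\preceq B$ (resp. $A\prec B$) means $B-A$ is positive semidefinite (resp. positive definite). SR1 update. For symmetric matrices $A,G$ (with $0\prec A\preceq G$) and $u\in\mathbb{R}^n$: $\mathrm{SR1}(A,G,u):=G$ if $(G-A)u=0$, and $\mathrm{SR1}(A,G,u):=G-\frac{(G-A)uu^\top(G-A)}{u^\top(G-A)u}$ otherwise. Algorithm Cubic SR1 PQN. Start with $x_0$, $G_0=LI$, $r_{-1}=0$. For $k=0,1,2,\dots$: (1) $x_{k+1}=\operatorname{argmin}_{x\in\mathbb{R}^n}\{g(x)+\langle\nabla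 f(x_k),x-x_k\rangle+\frac12\|x-x_k\|^2_{G_k+L_Hr_{k-1}I}+\frac{L_H}{3}\|x-x_k\|^3\}$; (2) $u_k=x_{k+1}-x_k$, $r_k=\|u_k\|$, $\lambda_k=L_Hr_{k-1}+L_Hr_k$; (3) $\tilde G_k=G_k+\lambda_kI$ and $F'(x_{k+1})=\nabla f(x_{k+1})-\nabla f(x_k)-\tilde G_ku_k$; (4) $J_k:=\int_0^1\nabla^2f(x_k+tu_k)\,dt$; (5) $G_{k+1}=\mathrm{SR1}(J_k,\tilde G_k,u_k)$; (6) if $\|F'(x_{k+1})\|=0$, terminate. Notation $F'$. $F'(x_k)=v_k+\nabla f(x_k)\in\partial F(x_k)$ with $v_k\in\partial g(x_k)$, where $v_{k+1}:=-\nabla f(x_k)-\tilde G_ku_k$ (this agrees with step (3)); for $k=0$ no particular choice of $v_0$ is prescribed. Standing convention. Without loss of generality $\|F'(x_k)\|>0$ for all $k\in\mathbb{N}$, since otherwise the algorithm terminates after finitely many steps and the rate holds until then. *)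

(* Defs.v *)
From HB Require Import structures.
From mathcomp Require Import all_boot all_order all_algebra.
From mathcomp Require Import all_classical all_reals all_analysis.

Set Implicit Arguments.
Unset Strict Implicit.
Unset Printing Implicit Defensive.

Import Order.TTheory GRing.Theory Num.Theory.
Import numFieldNormedType.Exports.

Local Open Scope classical_set_scope.
Local Open Scope ring_scope.

(* Points of R^n are column vectors. The library norm on matrices is the
   max-norm, so the Euclidean and spectral norms are introduced here; the
   topology (hence semicontinuity and differentiability) is unaffected. *)

Definition dot (R : realType) (n : nat) (x y : 'cV[R]_n) : R :=
  (x^T *m y) 0 0.

Definition enorm (R : realType) (n : nat) (x : 'cV[R]_n) : R :=
  Num.sqrt (dot x x).

Definition opnorm (R : realType) (n : nat) (A : 'M[R]_n) : R :=
  sup [set enorm (A *m v) | v in [set v : 'cV[R]_n | enorm v <= 1]].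

Definition sqnorm_mx (R : realType) (n : nat) (M : 'M[R]_n) (x : 'cV[R]_n) : R :=
  (x^T *m M *m x) 0 0.

Definition grad (R : realType) (n : nat) (f : 'cV[R]_n -> R) (x : 'cV[R]_n) :
    'cV[R]_n :=
  \col_i 'D_(delta_mx i 0) f x.

Definition hess (R : realType) (n : nat) (f : 'cV[R]_n -> R) (x : 'cV[R]_n) :
    'M[R]_n :=
  \matrix_(i, j) 'D_(delta_mx j 0) (fun y => grad f y i 0) x.

Definition twice_differentiable (R : realType) (n : nat)
    (f : 'cV[R]_n -> R) : Prop :=
  (forall x, differentiable f x) /\ (forall x, differentiable (grad f) x).

Definition lipschitz_grad (R : realType) (n : nat) (L : R)
    (f : 'cV[R]_n -> R) : Prop :=
  forall x y, enorm (grad f x - grad f y) <= L * enorm (x - y).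

Definition lipschitz_hess (R : realType) (n : nat) (LH : R)
    (f : 'cV[R]_n -> R) : Prop :=
  forall x y, opnorm (hess f x - hess f y) <= LH * enorm (x - y).

Definition strongly_convex (R : realType) (n : nat) (mu : R)
    (f : 'cV[R]_n -> R) : Prop :=
  forall (x y : 'cV[R]_n) (t : R), 0 <= t <= 1 ->
    f (t *: x + (1 - t) *: y) <=
      t * f x + (1 - t) * f y
      - mu / 2 * t * (1 - t) * enorm (x - y) ^+ 2.

(* Functions into R U {+oo} are \bar R-valued functions avoiding -oo. *)
Definition proper_fun (R : realType) (n : nat) (g : 'cV[R]_n -> \bar R) : Prop :=
  (forall x, g x != -oo%E) /\ (exists x, g x != +oo%E).

Definition econvex (R : realType) (n : nat) (g : 'cV[R]_n -> \bar R) : Prop :=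
  forall (x y : 'cV[R]_n) (t : R), 0 < t < 1 ->
    (g (t *: x + (1 - t) *: y)%R <= t%:E * g x + (1 - t)%R%:E * g y)%E.

(* For proper g this set is empty outside the domain of g. *)
Definition subdiff (R : realType) (n : nat) (g : 'cV[R]_n -> \bar R)
    (x : 'cV[R]_n) : set 'cV[R]_n :=
  [set v | forall y, (g x + (dot v (y - x)%R)%:E <= g y)%E].

Definition argmin (R : realType) (n : nat) (h : 'cV[R]_n -> \bar R) :
    set 'cV[R]_n :=
  [set x | forall y, (h x <= h y)%E].

Definition SR1 (R : realType) (n : nat) (A G : 'M[R]_n) (u : 'cV[R]_n) :
    'M[R]_n :=
  if (G - A) *m u == 0 then G
  else G - (dot u ((G - A) *m u))^-1 *:
           ((G - A) *m u *m u^T *m (G - A)).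

(* All quantities of the algorithm are functions of the iterates x. *)

Definition incr (R : realType) (n : nat) (x : nat -> 'cV[R]_n) (k : nat) :
    'cV[R]_n :=
  x k.+1 - x k.

Definition rlen (R : realType) (n : nat) (x : nat -> 'cV[R]_n) (k : nat) : R :=
  enorm (incr x k).

(* rprev x k is r_{k-1}, with r_{-1} = 0. *)
Definition rprev (R : realType) (n : nat) (x : nat -> 'cV[R]_n) (k : nat) : R :=
  if k is j.+1 then rlen x j else 0.

Definition lam (R : realType) (n : nat) (LH : R) (x : nat -> 'cV[R]_n)
    (k : nat) : R :=
  LH * rprev x k + LH * rlen x k.

Definition Jmx (R : realType) (n : nat) (f : 'cV[R]_n -> R)
    (x : nat -> 'cV[R]_n) (k : nat) : 'M[R]_n :=
  \matrix_(i, j)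
    \int[lebesgue_measure]_(t in `[0%R, 1%R]) hess f (x k + t *: incr x k) i j.

Fixpoint Gmx (R : realType) (n : nat) (f : 'cV[R]_n -> R) (L LH : R)
    (x : nat -> 'cV[R]_n) (k : nat) : 'M[R]_n :=
  if k is j.+1 then
    SR1 (Jmx f x j) (Gmx f L LH x j + (lam LH x j)%:M) (incr x j)
  else L%:M.

Definition Gtilde (R : realType) (n : nat) (f : 'cV[R]_n -> R) (L LH : R)
    (x : nat -> 'cV[R]_n) (k : nat) : 'M[R]_n :=
  Gmx f L LH x k + (lam LH x k)%:M.

Definition cubic_model (R : realType) (n : nat) (f : 'cV[R]_n -> R)
    (g : 'cV[R]_n -> \bar R) (L LH : R) (x : nat -> 'cV[R]_n) (k : nat)
    (y : 'cV[R]_n) : \bar R :=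
  let d := y - x k in
  let q := dot (grad f (x k)) d
           + 2^-1 * sqnorm_mx (Gmx f L LH x k + (LH * rprev x k)%:M) d
           + LH / 3 * enorm d ^+ 3 in
  (g y + q%:E)%E.

Definition vseq (R : realType) (n : nat) (f : 'cV[R]_n -> R) (L LH : R)
    (x : nat -> 'cV[R]_n) (v0 : 'cV[R]_n) (k : nat) : 'cV[R]_n :=
  if k is j.+1 then - grad f (x j) - Gtilde f L LH x j *m incr x j else v0.

Definition Fprime (R : realType) (n : nat) (f : 'cV[R]_n -> R) (L LH : R)
    (x : nat -> 'cV[R]_n) (v0 : 'cV[R]_n) (k : nat) : 'cV[R]_n :=
  vseq f L LH x v0 k + grad f (x k).

(* The algorithm performs its first N iterations, producing x 0, ..., x N:
   iteration k computes x k.+1, and the stopping test has not succeeded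
   at the end of an iteration before the last of these (it may succeed at
   x N). The values x k for k > N are irrelevant. *)
Definition cubic_SR1_PQN (R : realType) (n : nat) (f : 'cV[R]_n -> R)
    (g : 'cV[R]_n -> \bar R) (L LH : R) (x : nat -> 'cV[R]_n) (v0 : 'cV[R]_n)
    (N : nat) : Prop :=
  (forall k, (k < N)%N -> argmin (cubic_model f g L LH x k) (x k.+1)) /\
  (forall k, (0 < k < N)%N -> enorm (Fprime f L LH x v0 k) != 0).

Definition objective (R : realType) (n : nat) (f : 'cV[R]_n -> R)
    (g : 'cV[R]_n -> \bar R) (x : 'cV[R]_n) : \bar R :=
  (g x + (f x)%:E)%E.

Definition bounded_below (R : realType) (n : nat) (h : 'cV[R]_n -> \bar R) : Prop :=
  exists m : R, forall x, (m%:E <= h x)%E.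

Definition C0 (R : realType) (n : nat) (f : 'cV[R]_n -> R)
    (g : 'cV[R]_n -> \bar R) (mu : R) (x0 : 'cV[R]_n) : R :=
  Num.sqrt (2 * (fine (objective f g x0)
                 - fine (ereal_inf (range (objective f g)))) / mu).

Definition Crate (R : realType) (n : nat) (f : 'cV[R]_n -> R)
    (g : 'cV[R]_n -> \bar R) (mu L LH : R) (x0 : 'cV[R]_n) : R :=
  (2 * n%:R * LH * C0 f g mu x0 + n%:R * L) / mu.

(* Main.v *)
Require Import Defs.
From HB Require Import structures.
From mathcomp Require Import all_boot all_order all_algebra.
From mathcomp Require Import all_classical all_reals all_analysis.
From mathcomp Require Import ring lra.
Import Order.TTheory GRing.Theory Num.Theory.
Import numFieldNormedType.Exports.
Local Open Scope classical_set_scope.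
Local Open Scope ring_scope.

(** Let R_k := Gtilde_k - J_k. Since SR1 preserves J_k <= G and the shift lam_k I
    absorbs the drift of the averaged Hessians, every R_k is positive
    semidefinite, and F'(x_(k+1)) = - R_k u_k. Hence the objective decreases by at
    least mu/2 r_k^2 per step, so that sum r_k^2 <= C0^2. Each SR1 update lowers
    the trace of Gtilde_k by gain_k = |R_k u_k|^2 / <u_k, R_k u_k>; as the trace
    stays nonnegative, sum gain_k <= n L + n sum lam_k <= n L + 2 n L_H sqrt N C0.
    Strong monotonicity of the subdifferential of F gives
    <u_k, R_k u_k> <= |F'(x_k)|^2 / mu, that is,
    |F'(x_(k+1))|^2 <= (gain_k / mu) |F'(x_k)|^2, and the rate follows by
    multiplying these bounds and applying AM-GM to the gains. *)

(** * Euclidean inner product, norm and operator norm *)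

Section Euclidean.
Context {R : realType} {n : nat}.
Implicit Types (x y z u w : 'cV[R]_n) (A G : 'M[R]_n) (a : R).

Lemma dotE x y : dot x y = \sum_i x i 0 * y i 0.
Proof. by rewrite /dot mxE; apply: eq_bigr => i _; rewrite mxE. Qed.

Lemma dotC x y : dot x y = dot y x.
Proof. by rewrite !dotE; apply: eq_bigr => i _; rewrite mulrC. Qed.

Lemma dotDl x y z : dot (x + y) z = dot x z + dot y z.
Proof. by rewrite !dotE -big_split; apply: eq_bigr => i _; rewrite mxE mulrDl. Qed.

Lemma dotZl a x y : dot (a *: x) y = a * dot x y.
Proof. by rewrite !dotE mulr_sumr; apply: eq_bigr => i _; rewrite mxE mulrA. Qed.

Lemma dotNl x y : dot (- x) y = - dot x y.
Proof. by rewrite -scaleN1r dotZl mulN1r. Qed.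

Lemma dotBl x y z : dot (x - y) z = dot x z - dot y z.
Proof. by rewrite dotDl dotNl. Qed.

Lemma dotDr x y z : dot x (y + z) = dot x y + dot x z.
Proof. by rewrite !(dotC x) dotDl. Qed.

Lemma dotZr a x y : dot x (a *: y) = a * dot x y.
Proof. by rewrite !(dotC x) dotZl. Qed.

Lemma dotNr x y : dot x (- y) = - dot x y.
Proof. by rewrite !(dotC x) dotNl. Qed.

Lemma dotBr x y z : dot x (y - z) = dot x y - dot x z.
Proof. by rewrite dotDr dotNr. Qed.

Lemma dot0r x : dot x 0 = 0.
Proof. by rewrite -(scale0r 0) dotZr mul0r. Qed.

Lemma dot_ge0 x : 0 <= dot x x.
Proof. by rewrite dotE sumr_ge0 // => i _; rewrite -expr2 sqr_ge0. Qed.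

Lemma dot_eq0 x : (dot x x == 0) = (x == 0).
Proof.
apply/idP/eqP => [|->]; last by rewrite dot0r.
rewrite dotE psumr_eq0 => [/allP x0|i _]; last by rewrite -expr2 sqr_ge0.
apply/colP => i; rewrite mxE; apply/eqP.
by have := x0 i (mem_index_enum i); rewrite mulf_eq0 orbb.
Qed.

Lemma dot_delta_mx x i : dot (delta_mx i 0) x = x i 0.
Proof.
rewrite dotE (bigD1 i) //= big1 ?addr0 => [|j /negPf ji].
  by rewrite mxE !eqxx mul1r.
by rewrite mxE ji mul0r.
Qed.

Lemma enorm_ge0 x : 0 <= enorm x.
Proof. exact: sqrtr_ge0. Qed.

Lemma enorm_sqr x : enorm x ^+ 2 = dot x x.
Proof. by rewrite sqr_sqrtr // dot_ge0. Qed.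

Lemma enorm_eq0 x : (enorm x == 0) = (x == 0).
Proof. by rewrite -dot_eq0 -enorm_sqr sqrf_eq0. Qed.

Lemma enorm_gt0 x : (0 < enorm x) = (x != 0).
Proof. by rewrite lt0r enorm_eq0 enorm_ge0 andbT. Qed.

Lemma enormZ a x : enorm (a *: x) = `|a| * enorm x.
Proof. by rewrite /enorm dotZl dotZr mulrA -expr2 sqrtrM ?sqr_ge0 // sqrtr_sqr. Qed.

Lemma enormN x : enorm (- x) = enorm x.
Proof. by rewrite -scaleN1r enormZ normrN1 mul1r. Qed.

Lemma enorm_delta_mx (i : 'I_n) : enorm (delta_mx i 0 : 'cV[R]_n) = 1.
Proof. by rewrite /enorm dot_delta_mx mxE !eqxx sqrtr1. Qed.

Definition psd A := forall w, 0 <= dot w (A *m w).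

Lemma dot_mulmxr A x y : dot x (A *m y) = dot (A^T *m x) y.
Proof. by rewrite /dot trmx_mul trmxK mulmxA. Qed.

Lemma dot_sym A x y : A^T = A -> dot x (A *m y) = dot y (A *m x).
Proof. by move=> sA; rewrite dot_mulmxr sA dotC. Qed.

(* Discriminant of the nonnegative quadratic t |-> q(x + t y). *)
Lemma psd_cauchy_schwarz A x y : A^T = A -> psd A ->
  dot x (A *m y) ^+ 2 <= dot x (A *m x) * dot y (A *m y).
Proof.
move=> sA pA.
set a := dot y (A *m y); set b := dot x (A *m y); set c := dot x (A *m x).
have q s t : 0 <= s ^+ 2 * c + 2 * s * t * b + t ^+ 2 * a.
  have := pA (s *: x + t *: y).
  rewrite mulmxDr -!scalemxAr !(dotDl, dotDr, dotZl, dotZr).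
  rewrite (dot_sym A y x) // -/a -/b -/c => /le_trans -> //.
  by rewrite le_eqVlt; apply/orP; left; apply/eqP; ring.
have a0 : 0 <= a := pA y.
have [a00|a_neq0] := eqVneq a 0.
  suff -> : b = 0 by rewrite expr0n /= a00 mulr0.
  apply/eqP; apply/negPn/negP => b0.
  (* With [a = 0] the quadratic is affine in [t]; this [t] gives it the value -1. *)
  have := q 1 (- (c + 1) / (2 * b)).
  rewrite a00 (_ : 1 ^+ 2 * c + _ + _ = - 1); first by rewrite leNgt ltrN10.
  by field.
have := q a (- b).
rewrite (_ : _ + _ = a * (c * a - b ^+ 2)); last by ring.
by rewrite pmulr_rge0 ?subr_ge0 // lt0r a_neq0.
Qed.

Lemma sqr_dot_le x y : dot x y ^+ 2 <= dot x x * dot y y.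
Proof.
have := psd_cauchy_schwarz 1%:M x y (trmx1 _ _).
by rewrite !mul1mx; apply => w; rewrite mul1mx dot_ge0.
Qed.

Lemma normr_dot_le x y : `|dot x y| <= enorm x * enorm y.
Proof.
rewrite -(@ler_pXn2r _ 2) ?nnegrE ?mulr_ge0 ?enorm_ge0 ?normr_ge0 //.
by rewrite real_normK ?num_real // exprMn !enorm_sqr sqr_dot_le.
Qed.

Lemma dot_le x y : dot x y <= enorm x * enorm y.
Proof. by apply: le_trans (normr_dot_le x y); rewrite ler_norm. Qed.

Lemma ler_enormD x y : enorm (x + y) <= enorm x + enorm y.
Proof.
rewrite -(@ler_pXn2r _ 2) ?nnegrE ?addr_ge0 ?enorm_ge0 //.
rewrite sqrrD !enorm_sqr !(dotDl, dotDr) (dotC y x).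
have := dot_le x y; lra.
Qed.

Lemma ler_enorm_dist x y : `|enorm (x + y) - enorm x| <= enorm y.
Proof.
rewrite ler_norml; apply/andP; split; last first.
  by rewrite lerBlDl ler_enormD.
have := ler_enormD (x + y) (- y); rewrite addrK enormN; lra.
Qed.

(** Cauchy-Schwarz on each row bounds the set by the Frobenius norm, so the supremum in [opnorm] is
    a genuine one. *)
Lemma opnorm_has_sup A :
  has_sup [set enorm (A *m v) | v in [set v : 'cV[R]_n | enorm v <= 1]].
Proof.
split; first by exists (enorm (A *m 0)), 0 => //=; rewrite /enorm dot0r sqrtr0.
exists (Num.sqrt (\sum_i enorm (row i A)^T ^+ 2)) => _ [v /= v1 <-].
rewrite /enorm ler_wsqrtr // dotE ler_sum // => i _.
have -> : (A *m v) i 0 = dot (row i A)^T v.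
  by rewrite /dot trmxK -row_mul [RHS]mxE.
rewrite -expr2 enorm_sqr (le_trans (sqr_dot_le _ _)) //.
rewrite -[leRHS]mulr1 ler_wpM2l ?dot_ge0 // -enorm_sqr.
by rewrite expr_le1 ?enorm_ge0.
Qed.

Lemma opnorm_le A v : enorm (A *m v) <= opnorm A * enorm v.
Proof.
have [->|v0] := eqVneq v 0.
  by rewrite mulmx0 /enorm dot0r sqrtr0 mulr0.
have nv : 0 < enorm v by rewrite enorm_gt0.
rewrite -ler_pdivrMr // mulrC.
have -> : (enorm v)^-1 * enorm (A *m v) = enorm (A *m ((enorm v)^-1 *: v)).
  by rewrite -scalemxAr enormZ ger0_norm // invr_ge0 enorm_ge0.
apply: sup_upper_bound; first exact: opnorm_has_sup.
exists ((enorm v)^-1 *: v) => //=.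
by rewrite enormZ ger0_norm ?invr_ge0 ?enorm_ge0 // mulVf // gt_eqF.
Qed.

Lemma normr_form_le_opnorm A x y :
  `|dot x (A *m y)| <= opnorm A * (enorm x * enorm y).
Proof.
apply: le_trans (normr_dot_le _ _) _; rewrite mulrCA ler_wpM2l ?enorm_ge0 //.
exact: opnorm_le.
Qed.

Lemma mulmx_delta_col A i j : dot (delta_mx i 0) (A *m delta_mx j 0) = A i j.
Proof. by rewrite dot_delta_mx -colE mxE. Qed.

Lemma formE A x y : dot x (A *m y) = \sum_i \sum_j x i 0 * y j 0 * A i j.
Proof.
rewrite dotE; apply: eq_bigr => i _; rewrite mxE mulr_sumr.
by apply: eq_bigr => j _; ring.
Qed.

(** Cauchy-Schwarz for the form of [A], applied to [A *m x] and [x]: a vanishing form would force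
    [A *m x = 0]. It makes the SR1 denominator positive. *)
Lemma psd_mulmx_neq0 A x : A^T = A -> psd A -> A *m x != 0 ->
  0 < dot x (A *m x).
Proof.
move=> sA pA Ax0; rewrite lt0r pA andbT; apply/eqP => q0.
have := psd_cauchy_schwarz A (A *m x) x sA pA; rewrite q0 mulr0.
by rewrite leNgt exprn_even_gt0 //= dot_eq0 Ax0.
Qed.

(** * The SR1 update: order, symmetry and trace *)

Lemma mulmx_dyad A x y w : A *m x *m y^T *m w = dot y w *: (A *m x).
Proof.
rewrite -mulmxA (mx11_scalar (y^T *m w)) -/(dot y w).
by rewrite mul_mx_scalar.
Qed.

(** In the degenerate branch [(G - A) *m u = 0] the correction term vanishes, so one formula covers
    both branches. *)
Lemma SR1_sub_form A G u w : A^T = A -> G^T = G ->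
  dot w ((SR1 A G u - A) *m w) = dot w ((G - A) *m w)
    - (dot u ((G - A) *m u))^-1 * dot w ((G - A) *m u) ^+ 2.
Proof.
move=> sA sG; rewrite /SR1; case: eqP => [->|_].
  by rewrite !dot0r expr0n /= mulr0 subr0.
have sR : (G - A)^T = G - A by rewrite raddfB /= sG sA.
set M := G - A in sR *.
rewrite addrAC -/M mulmxBl -scalemxAl dotBr dotZr -!mulmxA mulmxA.
rewrite mulmxA mulmx_dyad dotZr (dot_sym M u w) // expr2; congr (_ - _ * _).
Qed.

(** By [SR1_sub_form] this is Cauchy-Schwarz for the form of [G - A] between [w] and [u], divided by
    the form at [u]. *)
Lemma SR1_psd A G u : A^T = A -> G^T = G -> psd (G - A) -> psd (SR1 A G u - A).
Proof.
move=> sA sG pR w; rewrite SR1_sub_form //.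
have sR : (G - A)^T = G - A by rewrite raddfB /= sG sA.
have [Ru0|/psd_mulmx_neq0] := eqVneq ((G - A) *m u) 0.
  by rewrite Ru0 !dot0r expr0n mulr0 subr0 pR.
move=> /(_ sR pR) uRu; rewrite subr_ge0 ler_pdivrMl //.
by rewrite mulrC; exact: psd_cauchy_schwarz.
Qed.

Lemma trmx_SR1 A G u : A^T = A -> G^T = G -> (SR1 A G u)^T = SR1 A G u.
Proof.
move=> sA sG; rewrite /SR1; case: ifP => // _.
have sR : (G - A)^T = G - A by rewrite raddfB /= sG sA.
rewrite raddfB /= linearZ /= sG; congr (_ - _ *: _).
by rewrite !trmx_mul trmxK sR !mulmxA.
Qed.

(* When (G - A) u = 0 the quotient is 0 / 0 = 0, in agreement with SR1. *)
Lemma mxtrace_SR1 A G u : A^T = A -> G^T = G ->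
  \tr (SR1 A G u) = \tr G - (dot u ((G - A) *m u))^-1 * enorm ((G - A) *m u) ^+ 2.
Proof.
move=> sA sG; rewrite /SR1 enorm_sqr; case: eqP => [->|_].
  by rewrite !dot0r mulr0 subr0.
have sR : (G - A)^T = G - A by rewrite raddfB /= sG sA.
rewrite raddfB /= linearZ /= -mulmxA mxtrace_mulC; congr (_ - _ * _).
rewrite -{1}sR -trmx_mul /dot [LHS](_ : _ = \tr (((G - A) *m u)^T *m ((G - A) *m u))) //.
exact: trace_mx11.
Qed.

Lemma mxtrace_psd_ge0 A : psd A -> 0 <= \tr A.
Proof.
move=> pA; apply: sumr_ge0 => i _.
by have := pA (delta_mx i 0); rewrite mulmx_delta_col.
Qed.

Lemma form_scalar_mx a w : dot w (a%:M *m w) = a * enorm w ^+ 2.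
Proof. by rewrite mul_scalar_mx dotZr enorm_sqr. Qed.

(** Adding [a] times the identity to [G] pays for replacing the lower bound [A] by [B], for instance
    one averaged Hessian by the next. *)
Lemma psd_shift G A B a : psd (G - A) ->
  (forall w, dot w (B *m w) <= dot w (A *m w) + a * enorm w ^+ 2) ->
  psd (G + a%:M - B).
Proof.
move=> pGA AB w; have := pGA w; have := AB w.
rewrite !(mulmxBl, mulmxDl, dotBr, dotDr) form_scalar_mx; lra.
Qed.

End Euclidean.

(** * One-variable limits, derivatives and integrals *)

Section RealLimits.
Context {R : realType}.
Implicit Types (a b c d h s t K : R) (phi psi : R -> R).

Lemma ler_vanishing_slack a b K :
  (forall h, 0 < h < 1 -> a <= b + h * K) -> a <= b.
Proof.
move=> ab; rewrite leNgt; apply/negP => ba.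
(* The choice [h = e / (2 * m)] lies in (0, 1) and, since [K <= m], has [h * K <= e / 2], which
   contradicts [a <= b + h * K]. *)
pose e := a - b; pose m := e + `|K| + 1.
have e0 : 0 < e by rewrite subr_gt0.
have em : e + K + 1 <= m by rewrite lerD2r lerD2l ler_norm.
have m0 : e < m by rewrite /m; have := normr_ge0 K; lra.
have m20 : 0 < 2 * m by lra.
have h0 : 0 < e / (2 * m) by rewrite divr_gt0.
have h1 : e / (2 * m) < 1 by rewrite ltr_pdivrMr //; lra.
have := ab (e / (2 * m)); rewrite h0 h1 => /(_ isT).
have : e / (2 * m) * K <= e / (2 * m) * m by rewrite ler_pM2l //; lra.
have -> : e / (2 * m) * m = e / 2 by field; lra.
rewrite /e; lra.
Qed.

(** The right difference quotients are at most [c + t * K], which tends to [c]. *)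
Lemma is_derive0_le phi d c K : is_derive (0 : R) 1 phi d ->
  (forall t, 0 < t < 1 -> phi t - phi 0 <= t * c + t ^+ 2 * K) -> d <= c.
Proof.
move=> [dphi <-] phic.
have cv : (fun h : R => h^-1 * (phi h - phi 0)) @ 0^'+ --> 'D_1 phi 0.
  apply: cvg_dnbhs_at_right; rewrite /derive.
  rewrite [X in X @ _ --> _](_ : _ =
      (fun h => h^-1 *: (phi (h *: 1 + 0) - phi 0))); first exact: dphi.
  by apply/funext => h; rewrite addr0 /GRing.scale /= mulr1.
have cv2 : (fun h : R => c + h * K) @ 0^'+ --> c + 0 * K.
  apply: cvgD; first exact: cvg_cst.
  by apply: cvgMl; apply: cvg_at_right_filter; exact: cvg_id.
rewrite mul0r addr0 in cv2.
apply: (ler_cvg_to cv cv2); near=> h.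
have h0 : 0 < h by near: h; exact: nbhs_right_gt.
rewrite ler_pdivrMl //; apply: le_trans (phic h _) _.
  by rewrite h0 /=; near: h; exact: nbhs_right_lt.
by rewrite expr2 -mulrA -mulrDr.
Unshelve. all: by end_near. Qed.

Lemma is_derive0_ge phi d c : is_derive (0 : R) 1 phi d ->
  (forall t, 0 < t < 1 -> t * c <= phi t - phi 0) -> c <= d.
Proof.
move=> dphi phic; rewrite -lerN2.
apply: (@is_derive0_le (- phi) (- d) (- c) 0).
move=> t /phic; rewrite mulr0 addr0 mulrN -opprB opprK fctE /=.
by lra.
Qed.

Lemma lipschitz_continuous phi K :
  (forall s t, `|phi s - phi t| <= K * `|s - t|) -> continuous phi.
Proof.
move=> lip s; apply/cvgrPdist_le => e e0; near=> t.
(* The sign of [K] is unknown; [|K| + 1] is a positive constant to divide by. *)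
apply: le_trans (lip s t) _; apply: (@le_trans _ _ ((`|K| + 1) * `|s - t|)).
  by rewrite ler_wpM2r // (le_trans (ler_norm _)) // lerDl.
have k0 : 0 < `|K| + 1 by rewrite ltr_wpDl.
rewrite -ler_pdivlMl // mulrC; near: t.
have : (id : R -> R) @ s --> s by exact: cvg_id.
by move/cvgrPdist_le; apply; rewrite divr_gt0.
Unshelve. all: by end_near. Qed.

(** * Integrals over the unit interval and the mean value theorem *)

Local Notation mu := (@lebesgue_measure R).
Local Notation I01 phi := (\int[mu]_(t in `[0%R, 1%R]) phi t).

Lemma integrable01 phi : continuous phi ->
  mu.-integrable `[0%R, 1%R] (EFin \o phi).
Proof.
move=> cphi; apply: continuous_compact_integrable; first exact: segment_compact.
exact: continuous_subspaceT.
Qed.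

Lemma Rintegral01_cst c : I01 (fun=> c) = c.
Proof.
rewrite Rintegral_cst //= lebesgue_measure_itv /= lte_fin ltr01 /=.
by rewrite subr0 mulr1.
Qed.

Lemma Rintegral01_le phi psi : continuous phi -> continuous psi ->
  (forall t, 0 <= t <= 1 -> phi t <= psi t) -> I01 phi <= I01 psi.
Proof.
move=> cphi cpsi le; apply: le_Rintegral => //; try exact: integrable01.
Qed.

Lemma Rintegral01D phi psi : continuous phi -> continuous psi ->
  I01 (fun t => phi t + psi t) = I01 phi + I01 psi.
Proof. by move=> cphi cpsi; rewrite RintegralD //; exact: integrable01. Qed.

Lemma Rintegral01_sum (I : Type) (s : seq I) (c : I -> R) (h : I -> R -> R) :
  (forall i, continuous (h i)) ->
  I01 (fun t => \sum_(i <- s) c i * h i t) = \sum_(i <- s) c i * I01 (h i).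
Proof.
move=> ch.
have cZ i : continuous (fun t => c i * h i t).
  by move=> t; apply: cvgM; [exact: cvg_cst|exact: ch].
have cS (r : seq I) : continuous (fun t => \sum_(i <- r) c i * h i t).
  elim: r => [|i r IH] t.
    by under eq_fun do rewrite big_nil; exact: cvg_cst.
  under eq_fun do rewrite big_cons.
  by apply: cvgD; [exact: cZ|exact: IH].
elim: s => [|i s IH].
  by under eq_Rintegral do rewrite big_nil; rewrite big_nil Rintegral01_cst.
under eq_Rintegral do rewrite big_cons.
rewrite big_cons Rintegral01D // IH RintegralZl //; exact: integrable01.
Qed.

Lemma Rintegral01_derive phi dphi : continuous dphi ->
  (forall t, is_derive (t : R) 1 phi (dphi t)) -> I01 dphi = phi 1 - phi 0.
Proof.
move=> cd dphiE.
have cphi : continuous phi.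
  move=> t; apply/differentiable_continuous/derivable1_diffP.
  by have [] := dphiE t.
rewrite /Rintegral (@continuous_FTC2 _ dphi phi) //.
- exact: continuous_subspaceT.
- split; first by move=> t _; have [] := dphiE t.
  + exact: cvg_at_right_filter (cphi 0).
  + exact: cvg_at_left_filter (cphi 1).
- by move=> t _; rewrite derive1E; have [] := dphiE t.
Qed.

Lemma MVT0 phi dphi h : 0 < h -> (forall t, is_derive (t : R) 1 phi (dphi t)) ->
  exists2 s, 0 <= s <= h & phi h - phi 0 = h * dphi s.
Proof.
move=> h0 dphiE.
have [|s] := @MVT_segment _ phi dphi 0 h (ltW h0) (fun t _ => dphiE t).
  apply: continuous_subspaceT => t.
  apply/differentiable_continuous/derivable1_diffP.
  by have [] := dphiE t.
by rewrite in_itv /= subr0 mulrC => ? ?; exists s.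
Qed.

End RealLimits.

(** * Gradients and Hessians along lines *)

Section Calculus.
Context {R : realType} {n : nat}.
Implicit Types (f : 'cV[R]_n -> R) (x y u v w a b : 'cV[R]_n) (t s h : R).

(** The difference quotient of the restriction to the line is literally that of [f] in direction
    [u]. *)
Lemma is_derive_line f x u t : differentiable f (x + t *: u) ->
  is_derive (t : R) 1 (fun s => f (x + s *: u)) ('D_u f (x + t *: u)).
Proof.
move=> dfx; have df : derivable f (x + t *: u) u by exact: diff_derivable.
have E : (fun h : R => h^-1 *: (f (x + (h *: 1 + t) *: u) - f (x + t *: u))) =
    (fun h : R => h^-1 *: (f (h *: u + (x + t *: u)) - f (x + t *: u))).
  apply/funext => h; congr (_ *: (f _ - _)).
  by rewrite [h *: 1]mulr1 scalerDl addrCA.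
split; first by rewrite /derivable; rewrite /= E; exact: df.
by rewrite /derive /= E.
Qed.

Lemma derive_sum_coord f x v : differentiable f x ->
  'D_v f x = \sum_i v i 0 * 'D_(delta_mx i 0) f x.
Proof.
move=> df; rewrite (deriveE v df) {1}(matrix_sum_delta v) linear_sum.
apply: eq_bigr => i _; rewrite big_ord1 linearZ /= deriveE //.
Qed.

Lemma derive_grad f x v : differentiable f x -> 'D_v f x = dot (grad f x) v.
Proof.
by move=> df; rewrite derive_sum_coord // dotE; apply: eq_bigr => i _;
  rewrite mxE mulrC.
Qed.

Lemma differentiable_dotl (F : 'cV[R]_n -> 'cV[R]_n) a x :
  differentiable F x -> differentiable (fun y => dot a (F y)) x.
Proof.
move=> dF.
rewrite (_ : (fun _ => _) = \sum_i (a i 0 *: (fun y => F y i 0))); last first.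
  by apply/funext => y; rewrite dotE fct_sumE.
apply: differentiable_sum => i; apply: differentiableZ.
exact: (differentiable_comp dF (differentiable_coord _ _ _)).
Qed.

Lemma derive_dot_grad f a x v : differentiable (grad f) x ->
  'D_v (fun y => dot a (grad f y)) x = dot a (hess f x *m v).
Proof.
move=> dg.
have dgi i : differentiable (fun y => grad f y i 0) x.
  exact: (differentiable_comp dg (differentiable_coord _ _ _)).
rewrite (_ : (fun _ => _) = \sum_i (a i 0 *: (fun y => grad f y i 0)));
  last by apply/funext => y; rewrite dotE fct_sumE.
rewrite derive_sum => [|i]; last exact/derivableZ/diff_derivable.
rewrite dotE; apply: eq_bigr => i _; rewrite deriveZ; last exact/diff_derivable.
rewrite [LHS]/( _ * _) /= derive_sum_coord // mxE; congr (_ * _).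
by apply: eq_bigr => j _; rewrite [hess f x i j]mxE mulrC.
Qed.

Lemma is_derive_line_grad f x u t : twice_differentiable f ->
  is_derive (t : R) 1 (fun s => f (x + s *: u)) (dot (grad f (x + t *: u)) u).
Proof.
move=> [df _]; rewrite -(derive_grad _ _ u (df (x + t *: u))).
exact: is_derive_line.
Qed.

Lemma is_derive_line_hess f a x u t : twice_differentiable f ->
  is_derive (t : R) 1 (fun s => dot a (grad f (x + s *: u)))
    (dot a (hess f (x + t *: u) *m u)).
Proof.
move=> [_ dg]; rewrite -(derive_dot_grad _ a _ u (dg (x + t *: u))).
apply: (is_derive_line (fun y => dot a (grad f y))).
exact: differentiable_dotl.
Qed.

(** Reduces the operator-norm hypothesis to scalar functions, the form in which it is used from here
    on. *)
Lemma hess_form_lipschitz f LH a b x y : lipschitz_hess LH f ->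
  `|dot a (hess f x *m b) - dot a (hess f y *m b)|
    <= LH * enorm (x - y) * (enorm a * enorm b).
Proof.
move=> lip; rewrite -dotBr -mulmxBl; apply: le_trans (normr_form_le_opnorm _ _ _) _.
by apply: ler_wpM2r; rewrite ?mulr_ge0 ?enorm_ge0.
Qed.

(* Both mixed derivatives are approximated, up to O(h), by the same second
   difference of f divided by h^2; [E] bounds the error for one of them. *)
Lemma trmx_hess f LH x : 0 < LH -> twice_differentiable f -> lipschitz_hess LH f ->
  (hess f x)^T = hess f x.
Proof.
move=> LH0 df lip.
have E a b h : 0 < h ->
    `|(f (x + h *: a + h *: b) - f (x + h *: a) - f (x + h *: b) + f x) -
      h ^+ 2 * dot a (hess f x *m b)|
    <= h ^+ 3 * (LH * (enorm a + enorm b) * (enorm a * enorm b)).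
  move=> h0.
  (* [phi h - phi 0] is the second difference. The mean value theorem in direction [a], then in
     direction [b], makes it [h ^+ 2] times a Hessian form at a point within
     [h * (enorm a + enorm b)] of [x]. *)
  pose phi s := f (x + h *: b + s *: a) - f (x + s *: a).
  have dphi s : is_derive (s : R) 1 phi
      (dot (grad f (x + h *: b + s *: a)) a - dot (grad f (x + s *: a)) a).
    apply: is_deriveB; exact: is_derive_line_grad.
  have [s /andP[s0 sh] phiE] := MVT0 _ _ _ h0 dphi.
  have [t /andP[t0 th] psiE] := MVT0 _ _ _ h0
    (fun t => is_derive_line_hess f a (x + s *: a) b t df).
  have -> : f (x + h *: a + h *: b) - f (x + h *: a) - f (x + h *: b) + f x =
      h ^+ 2 * dot a (hess f (x + s *: a + t *: b) *m b).
    transitivity (phi h - phi 0).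
      by rewrite /phi scale0r !addr0 (addrAC x (h *: b)); ring.
    rewrite phiE expr2 -mulrA -psiE scale0r addr0 (addrAC x (s *: a)).
    by rewrite !(dotC a).
  rewrite -mulrBr normrM (ger0_norm (sqr_ge0 h)) [h ^+ 3]exprSr -[leRHS]mulrA.
  rewrite ler_wpM2l ?sqr_ge0 //; apply: le_trans (hess_form_lipschitz _ _ _ _ _ _ lip) _.
  rewrite [leRHS]mulrA; apply: ler_wpM2r; rewrite ?mulr_ge0 ?enorm_ge0 //.
  rewrite mulrCA ler_wpM2l ?(ltW LH0) // -(addrA x) (addrC x) addrK.
  apply: le_trans (ler_enormD _ _) _; rewrite !enormZ !ger0_norm // mulrDr.
  by rewrite lerD // ler_wpM2r ?enorm_ge0.
apply/matrixP => i j; rewrite mxE -!mulmx_delta_col.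
set a := delta_mx i 0; set b := delta_mx j 0.
pose K := 2 * (LH * (enorm a + enorm b) * (enorm a * enorm b)).
have key : `|dot b (hess f x *m a) - dot a (hess f x *m b)| <= 0.
  (* The two errors, from [E a b] and [E b a], add up to [h ^+ 3 * K]; dividing by [h ^+ 2] leaves a
     slack [h * K]. *)
  apply: (ler_vanishing_slack _ _ K) => h /andP[h0 _]; rewrite add0r.
  have h2 : 0 < h ^+ 2 by rewrite exprn_gt0.
  rewrite -(ler_pM2l h2) -{1}(ger0_norm (ltW h2)) -normrM mulrBr.
  have := E a b h h0; have := E b a h h0.
  rewrite (addrAC x (h *: b)) (addrAC _ (- f (x + h *: b))) (addrC (enorm b)).
  rewrite (mulrC (enorm b)); set D := _ + f x.
  move: (LH * _ * _) @K => B K; rewrite !ler_norml => /andP[e1 e2] /andP[e3 e4].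
  by rewrite /K; apply/andP; split; lra.
by apply/eqP; rewrite -subr_eq0 -normr_le0.
Qed.

(** * Averaged Hessians *)

(** [Jmx] with a free base point and step, so that the averages of consecutive iterations can be
    compared. *)
Definition mean_hess f x u : 'M[R]_n :=
  \matrix_(i, j)
    \int[lebesgue_measure]_(t in `[0%R, 1%R]) hess f (x + t *: u) i j.

Lemma continuous_hess_form f LH a b x u : lipschitz_hess LH f ->
  continuous (fun t : R => dot a (hess f (x + t *: u) *m b)).
Proof.
move=> lip; apply: (lipschitz_continuous _ (LH * enorm u * (enorm a * enorm b))).
move=> s t; apply: le_trans (hess_form_lipschitz _ _ _ _ _ _ lip) _.
rewrite opprD addrACA subrr add0r -scalerBl enormZ.
by rewrite le_eqVlt; apply/orP; left; apply/eqP; ring.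
Qed.

(** The entrywise integral commutes with the finite sum defining the form; bounds on Hessian forms
    then pass to the average by monotonicity of the integral. *)
Lemma mean_hess_form f LH a b x u : lipschitz_hess LH f ->
  dot a (mean_hess f x u *m b) =
    \int[lebesgue_measure]_(t in `[0%R, 1%R]) dot a (hess f (x + t *: u) *m b).
Proof.
move=> lip; rewrite formE pair_bigA /=.
under eq_Rintegral do rewrite formE pair_bigA /=.
rewrite Rintegral01_sum => [|[i j] /=].
  by apply: eq_bigr => p _; rewrite mxE.
under eq_fun do rewrite -mulmx_delta_col.
exact: continuous_hess_form lip.
Qed.

Lemma trmx_mean_hess f LH x u : 0 < LH -> twice_differentiable f ->
  lipschitz_hess LH f -> (mean_hess f x u)^T = mean_hess f x u.
Proof.
move=> LH0 df lip; apply/matrixP => i j; rewrite !mxE.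
by apply: eq_Rintegral => t _; rewrite -{1}(trmx_hess _ _ _ LH0 df lip) mxE.
Qed.

(** The secant equation: the fundamental theorem of calculus for each coordinate of the gradient
    along the segment. *)
Lemma mean_hess_mul f LH x u : twice_differentiable f -> lipschitz_hess LH f ->
  mean_hess f x u *m u = grad f (x + u) - grad f x.
Proof.
move=> df lip; apply/colP => i; rewrite -[LHS]dot_delta_mx -[RHS]dot_delta_mx.
rewrite (mean_hess_form _ _ _ _ _ _ lip).
rewrite (Rintegral01_derive _ _ _
  (fun t => is_derive_line_hess f (delta_mx i 0) x u t df)).
  by rewrite scale0r scale1r addr0 dotBr.
exact: continuous_hess_form lip.
Qed.

Lemma mean_hess_form_ge f LH c a x u : lipschitz_hess LH f ->
  (forall y, c <= dot a (hess f y *m a)) -> c <= dot a (mean_hess f x u *m a).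
Proof.
move=> lip cle; rewrite (mean_hess_form _ _ _ _ _ _ lip) -[leLHS]Rintegral01_cst.
apply: Rintegral01_le => [||t _]; last exact: cle.
  by move=> t; exact: cvg_cst.
exact: continuous_hess_form lip.
Qed.

Lemma mean_hess_form_le f LH c a x u : lipschitz_hess LH f ->
  (forall y, dot a (hess f y *m a) <= c) -> dot a (mean_hess f x u *m a) <= c.
Proof.
move=> lip cle; rewrite (mean_hess_form _ _ _ _ _ _ lip) -[leRHS]Rintegral01_cst.
apply: Rintegral01_le => [||t _]; last exact: cle.
  exact: continuous_hess_form lip.
by move=> t; exact: cvg_cst.
Qed.

(** At equal [t] the two sample points differ by [(1 - t) *: u + t *: v], of norm at most
    [enorm u + enorm v]. For consecutive steps [u] and [v] the drift coefficient is exactly the next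
    [lam]. *)
Lemma mean_hess_form_shift f LH a x u v : 0 < LH -> lipschitz_hess LH f ->
  dot a (mean_hess f (x + u) v *m a) <=
    dot a (mean_hess f x u *m a) + LH * (enorm u + enorm v) * enorm a ^+ 2.
Proof.
move=> LH0 lip; rewrite [leLHS](mean_hess_form _ _ _ _ _ _ lip).
rewrite [X in _ <= X + _](mean_hess_form _ _ _ _ _ _ lip).
set c := LH * _ * _; rewrite -[X in _ <= _ + X]Rintegral01_cst.
rewrite -[leRHS]Rintegral01D; last 2 first.
- exact: continuous_hess_form lip.
- by move=> t; exact: cvg_cst.
apply: Rintegral01_le.
- exact: continuous_hess_form lip.
- move=> t; apply: cvgD; last exact: cvg_cst.
  exact: (continuous_hess_form f LH a a x u lip t).
move=> t /andP[t0 t1]; rewrite -lerBlDl.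
apply: le_trans (ler_norm _) _; apply: le_trans (hess_form_lipschitz _ _ _ _ _ _ lip) _.
rewrite /c -expr2 ler_wpM2r ?sqr_ge0 // ler_wpM2l ?(ltW LH0) //.
have -> : x + u + t *: v - (x + t *: u) = (1 - t) *: u + t *: v.
  by rewrite scalerBl scale1r; apply/colP => i; rewrite !mxE; ring.
apply: le_trans (ler_enormD _ _) _; rewrite !enormZ !ger0_norm ?subr_ge0 //.
by rewrite lerD // ler_piMl ?enorm_ge0 // lerBlDr lerDl.
Qed.

(** * Consequences of strong convexity and of the Lipschitz gradient *)

Lemma strongly_convex_grad f mu x y : twice_differentiable f ->
  strongly_convex mu f ->
  f x + dot (grad f x) (y - x) + mu / 2 * enorm (y - x) ^+ 2 <= f y.
Proof.
move=> df sc; rewrite -lerBrDr addrC -lerBrDr.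
have := is_derive_line_grad f x (y - x) 0 df; rewrite scale0r addr0 => d0.
(* The slack constant comes from the quadratic part of [t * (1 - t) = t - t ^+ 2]. *)
apply: (is_derive0_le _ _ _ (mu / 2 * enorm (y - x) ^+ 2) d0) => t /andP[t0 t1].
have := sc y x t; rewrite (ltW t0) (ltW t1) => /(_ isT).
have -> : t *: y + (1 - t) *: x = x + t *: (y - x).
  by apply/colP => i; rewrite !mxE; ring.
rewrite scale0r addr0 => H; rewrite lerBlDr; apply: le_trans H _.
by rewrite le_eqVlt; apply/orP; left; apply/eqP; ring.
Qed.

Lemma strongly_convex_grad_mono f mu x y : twice_differentiable f ->
  strongly_convex mu f ->
  mu * enorm (y - x) ^+ 2 <= dot (grad f y - grad f x) (y - x).
Proof.
move=> df sc; have := strongly_convex_grad f mu x y df sc.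
have := strongly_convex_grad f mu y x df sc.
by rewrite -(opprB y x) enormN dotNr dotBl; lra.
Qed.

(** The form is the derivative at 0 of [dot w (grad f (y + t *: w))], whose increments are
    nonnegative because the gradient is monotone. *)
Lemma hess_form_ge0 f mu w y : 0 < mu -> twice_differentiable f ->
  strongly_convex mu f -> 0 <= dot w (hess f y *m w).
Proof.
move=> mu0 df sc; have := is_derive_line_hess f w y w 0 df.
rewrite scale0r addr0 => d0; apply: (is_derive0_ge _ _ _ d0) => t /andP[t0 _].
rewrite mulr0 scale0r addr0 -(pmulr_rge0 _ t0) -dotBr dotC -dotZr.
have := strongly_convex_grad_mono f mu y (y + t *: w) df sc.
rewrite addrAC subrr add0r; apply: le_trans.
by rewrite mulr_ge0 ?sqr_ge0 // ltW.
Qed.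

Lemma hess_form_le f L w y : twice_differentiable f -> lipschitz_grad L f ->
  dot w (hess f y *m w) <= L * enorm w ^+ 2.
Proof.
move=> df lip; have := is_derive_line_hess f w y w 0 df.
rewrite scale0r addr0 => d0; apply: (is_derive0_le _ _ _ 0 d0) => t /andP[t0 _].
rewrite mulr0 scale0r !addr0 -dotBr; apply: le_trans (dot_le _ _) _.
have := lip (y + t *: w) y; rewrite addrAC subrr add0r enormZ gtr0_norm // => H.
apply: le_trans (ler_wpM2l (enorm_ge0 _) H) _.
by rewrite le_eqVlt; apply/orP; left; apply/eqP; ring.
Qed.

End Calculus.

(** * Optimality condition of the cubic subproblem *)

Section CubicModel.
Context {R : realType} {n : nat}.

(* For a = |u| and b = |u + h d|, b^3 - a^3 = 3/2 a (b^2 - a^2) + (b - a)^2 (b + a/2)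
   and |b - a| <= h |d|. *)
Lemma enorm_cube_expand (u d : 'cV[R]_n) (h : R) : 0 < h < 1 ->
  enorm (u + h *: d) ^+ 3 <= enorm u ^+ 3 + h * (3 * enorm u * dot u d)
    + h ^+ 2 * (3 * enorm u * enorm d ^+ 2 + enorm d ^+ 3).
Proof.
move=> /andP[h0 h1].
have b2 : enorm (u + h *: d) ^+ 2 =
    enorm u ^+ 2 + h * (2 * dot u d) + h ^+ 2 * enorm d ^+ 2.
  by rewrite !enorm_sqr !(dotDl, dotDr, dotZl, dotZr) (dotC d u); ring.
have := ler_enorm_dist u (h *: d); rewrite enormZ (gtr0_norm h0).
have := enorm_ge0 (u + h *: d).
have := enorm_ge0 d; have := enorm_ge0 u; move: b2.
set b := enorm (u + h *: d); set a := enorm u; set e := enorm d.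
move=> b2 a0 e0 b0 bae.
have bae2 : (b - a) ^+ 2 <= h ^+ 2 * e ^+ 2.
  rewrite -exprMn -[leLHS]real_normK ?num_real // lerXn2r ?nnegrE //.
  by rewrite mulr_ge0 // ltW.
have bs : b + a / 2 <= 3 / 2 * a + e.
  have : h * e <= e by rewrite ler_piMl // ltW.
  by move: (le_trans (ler_norm _) bae); lra.
have s0 : 0 <= b + a / 2 by lra.
have key := ler_pM (sqr_ge0 _) s0 bae2 bs.
have -> : b ^+ 3 = a ^+ 3 + 3 / 2 * a * (b ^+ 2 - a ^+ 2)
    + (b - a) ^+ 2 * (b + a / 2) by field.
rewrite b2; apply: (@le_trans _ _ (a ^+ 3 + 3 / 2 * a *
  (a ^+ 2 + h * (2 * dot u d) + h ^+ 2 * e ^+ 2 - a ^+ 2)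
  + h ^+ 2 * e ^+ 2 * (3 / 2 * a + e))); first by rewrite lerD2l.
by rewrite le_eqVlt; apply/orP; left; apply/eqP; field.
Qed.

(** The real-valued part of [cubic_model] as a function of the displacement [d]. *)
Definition cubic_form (c : 'cV[R]_n) (M : 'M[R]_n) (H : R) (d : 'cV[R]_n) : R :=
  dot c d + 2^-1 * sqnorm_mx M d + H / 3 * enorm d ^+ 3.

(** The cubic term contributes [H * enorm u] times [u] to the gradient. A one-sided expansion
    suffices for optimality and spares differentiating the norm, also at [u = 0]. *)
Lemma cubic_form_expand c M H u d : M^T = M -> 0 < H ->
  exists K, forall h : R, 0 < h < 1 -> cubic_form c M H (u + h *: d) <=
    cubic_form c M H u + h * dot (c + (M + (H * enorm u)%:M) *m u) d + h ^+ 2 * K.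
Proof.
move=> sM H0; exists (2^-1 * dot d (M *m d)
  + H / 3 * (3 * enorm u * enorm d ^+ 2 + enorm d ^+ 3)) => h h01.
rewrite /cubic_form.
have sqE w : sqnorm_mx M w = dot w (M *m w) by rewrite /sqnorm_mx /dot mulmxA.
rewrite !sqE mulmxDl mul_scalar_mx mulmxDr -!scalemxAr.
rewrite !(dotDl, dotDr, dotZl, dotZr) (dot_sym M u d) // (dotC (M *m u) d).
have H3 : 0 <= H / 3 by lra.
have := ler_wpM2l H3 (enorm_cube_expand u d h h01).
move=> /(lerD (lexx _)) /le_trans; apply.
by rewrite le_eqVlt; apply/orP; left; apply/eqP; field.
Qed.

Lemma argmin_fin_num (g : 'cV[R]_n -> \bar R) (q : 'cV[R]_n -> R) z :
  proper_fun g -> argmin (fun y => (g y + (q y)%:E)%E) z -> g z \is a fin_num.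
Proof.
move=> [gN [p gp]] /(_ p); rewrite fin_numE gN /=.
case: (g z) (g p) (gN p) gp => [r||] [s||] //=.
Qed.

(** Fermat's rule by hand: compare [z] with [h *: y + (1 - h) *: z], bound [g] there by convexity
    and the cubic by its expansion, divide by [h] and let [h] tend to 0. *)
Lemma cubic_argmin_subdiff (g : 'cV[R]_n -> \bar R) c M H x z :
  proper_fun g -> econvex g -> M^T = M -> 0 < H ->
  argmin (fun y => (g y + (cubic_form c M H (y - x))%:E)%E) z ->
  subdiff g z (- c - (M + (H * enorm (z - x))%:M) *m (z - x)).
Proof.
move=> pg cg sM H0 zmin y.
have := argmin_fin_num _ _ _ pg zmin.
case Ez : (g z) => [s||] // _.
case Ey : (g y) => [r||]; last 2 first.
- by rewrite leey.
- by have := pg.1 y; rewrite Ey eqxx.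
rewrite -EFinD lee_fin -opprD dotNl.
have [K HK] := cubic_form_expand c M H (z - x) (y - z) sM H0.
apply: (ler_vanishing_slack _ _ K) => h h01; have /andP[h0 h1] := h01.
have := zmin (h *: y + (1 - h) *: z).
have := cg y z h h01; rewrite Ez Ey -!EFinM -EFinD.
have -> : h *: y + (1 - h) *: z - x = z - x + h *: (y - z).
  by apply/colP => i; rewrite !mxE; ring.
move=> /(leeD2r (cubic_form c M H (z - x + h *: (y - z)))%:E) gle /le_trans.
move=> /(_ _ gle); rewrite -!EFinD lee_fin.
have := HK h h01; set A := cubic_form _ _ _ _; set B := cubic_form _ _ _ _.
set D := dot _ _ => BA sB.
have : h * (s - D - r - h * K) <= 0 by rewrite expr2 in BA; lra.
by rewrite pmulr_rle0 //; lra.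
Qed.

Lemma subdiff_monotone (g : 'cV[R]_n -> \bar R) x y v w :
  g x \is a fin_num -> g y \is a fin_num -> subdiff g x v -> subdiff g y w ->
  0 <= dot (w - v) (y - x).
Proof.
move=> gx gy /(_ y) + /(_ x).
rewrite -(fineK gx) -(fineK gy) -!EFinD !lee_fin -(opprB y x) dotNr dotBl.
by lra.
Qed.

End CubicModel.

(** * The iterates: order relations, residuals and subgradients *)

Section Algorithm.
Context (R : realType) (n : nat) (f : 'cV[R]_n -> R) (g : 'cV[R]_n -> \bar R).
Context (mu L LH : R) (mu_gt0 : 0 < mu) (L_gt0 : 0 < L) (LH_gt0 : 0 < LH).
Context (g_proper : proper_fun g) (g_convex : econvex g).
Context (f_diff2 : twice_differentiable f) (f_sconvex : strongly_convex mu f).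
Context (f_grad : lipschitz_grad L f) (f_hess : lipschitz_hess LH f).
Context (F_bounded : bounded_below (objective f g)).
Context (x : nat -> 'cV[R]_n) (v0 : 'cV[R]_n) (N : nat).
Context (v0_subgrad : subdiff g (x 0%N) v0).
Context (x_run : forall k, (k < N)%N -> argmin (cubic_model f g L LH x k) (x k.+1)).

Local Notation J := (Jmx f x).
Local Notation G := (Gmx f L LH x).
Local Notation Gt := (Gtilde f L LH x).
Local Notation u := (incr x).
Local Notation r := (rlen x).
Local Notation v := (vseq f L LH x v0).
Local Notation F' := (Fprime f L LH x v0).

Let Err k := Gt k - J k.
Let gain k := (dot (u k) (Err k *m u k))^-1 * enorm (Err k *m u k) ^+ 2.
(** A real-valued objective; it represents [objective] at the iterates up to [N], where [g] is
    finite. *)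
Let Fval k := fine (g (x k)) + f (x k).

Lemma rlen_ge0 k : 0 <= r k.
Proof. exact: enorm_ge0. Qed.

Lemma xS k : x k.+1 = x k + u k.
Proof. by rewrite /incr addrC subrK. Qed.

Lemma JmxE k : J k = mean_hess f (x k) (u k).
Proof. by []. Qed.

Lemma trmx_Jmx k : (J k)^T = J k.
Proof. by rewrite JmxE (trmx_mean_hess _ _ _ _ LH_gt0 f_diff2 f_hess). Qed.

Lemma Jmx_psd k : psd (J k).
Proof.
move=> w; rewrite JmxE; apply: (mean_hess_form_ge _ _ _ _ _ _ f_hess) => y.
exact: hess_form_ge0 mu_gt0 f_diff2 f_sconvex.
Qed.

Lemma Gmx_sym k : (G k)^T = G k.
Proof.
elim: k => [|k IH] /=; first by rewrite tr_scalar_mx.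
by apply: trmx_SR1; rewrite ?trmx_Jmx // raddfD /= tr_scalar_mx IH.
Qed.

Lemma Gtilde_sym k : (Gt k)^T = Gt k.
Proof. by rewrite /Gtilde raddfD /= tr_scalar_mx Gmx_sym. Qed.

Lemma Err_sym k : (Err k)^T = Err k.
Proof. by rewrite raddfB /= Gtilde_sym trmx_Jmx. Qed.

(* The shift lam_(k+1) I absorbs the variation of the averaged Hessian between
   consecutive steps, and SR1 preserves J_k <= G. *)
Lemma Err_psd k : psd (Err k).
Proof.
elim: k => [|k IH].
  (* Base case: the Lipschitz gradient puts [J 0] below [L] times the identity, and the shift [lam]
     is nonnegative. *)
  apply: (psd_shift _ L%:M) => [|w].
    by rewrite subrr => w; rewrite mul0mx dot0r.
  rewrite form_scalar_mx JmxE.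
  have := mean_hess_form_le _ _ _ w (x 0%N) (u 0%N) f_hess
    (fun y => hess_form_le _ _ w y f_diff2 f_grad).
  move=> /le_trans; apply; rewrite lerDl mulr_ge0 ?sqr_ge0 //.
  by rewrite /lam mulr0 add0r mulr_ge0 ?rlen_ge0 // ltW.
apply: psd_shift (SR1_psd _ _ (u k) (trmx_Jmx k) (Gtilde_sym k) IH) _ => w.
rewrite !JmxE [x k.+1]xS /lam /= -mulrDr.
exact: mean_hess_form_shift LH_gt0 f_hess.
Qed.

(** The secant equation replaces the gradient difference by [J k *m u k]. *)
Lemma Fprime_S k : F' k.+1 = - (Err k *m u k).
Proof.
rewrite /Fprime /= mulmxBl JmxE (mean_hess_mul _ _ _ _ f_diff2 f_hess) -xS.
by apply/colP => i; rewrite !mxE; ring.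
Qed.

(** At [x 0] an infinite value would, by the subgradient inequality for [v0], make [g] infinite
    everywhere; later iterates are minimizers. *)
Lemma g_fin k : (k <= N)%N -> g (x k) \is a fin_num.
Proof.
case: k => [_|k kN]; last exact: (argmin_fin_num _ _ _ g_proper (x_run k kN)).
have [gN [p gp]] := g_proper; have := v0_subgrad p; rewrite fin_numE gN /=.
by case: (g (x 0%N)) (g p) (gN p) gp => [a||] [b||].
Qed.

Lemma vseq_subdiff k : (k <= N)%N -> subdiff g (x k) (v k).
Proof.
case: k => [_ //|k kN] /=.
have sM : (G k + (LH * rprev x k)%:M)^T = G k + (LH * rprev x k)%:M.
  by rewrite raddfD /= tr_scalar_mx Gmx_sym.
have := cubic_argmin_subdiff _ _ _ _ _ _ g_proper g_convex sM LH_gt0 (x_run k kN).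
(* The two halves of [lam] have different origins: [rprev] from the quadratic term, [r k] from the
   gradient of the cubic term. *)
suff -> : Gt k = G k + (LH * rprev x k)%:M + (LH * r k)%:M by [].
by rewrite -addrA -(raddfD (@scalar_mx R n)).
Qed.

(** * Descent of the objective and summability of the steps *)

Lemma dot_Fprime_S k : dot (F' k.+1) (u k) = - dot (u k) (Err k *m u k).
Proof. by rewrite Fprime_S dotNl dotC. Qed.

(** Add the subgradient inequality of [g] and the strong convexity bound of [f], both based at
    [x k.+1] and tested at [x k]; the linear term left over is the form of [Err k] at [u k], which
    is nonnegative. *)
Lemma descent k : (k < N)%N -> mu / 2 * r k ^+ 2 <= Fval k - Fval k.+1.
Proof.
move=> kN.
have := vseq_subdiff k.+1 kN (x k).
rewrite -(fineK (g_fin _ kN)) -(fineK (g_fin _ (ltnW kN))) -EFinD lee_fin.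
have := strongly_convex_grad f mu (x k.+1) (x k) f_diff2 f_sconvex.
rewrite -(opprB (x k.+1)) -/(u k) enormN -/(r k) !dotNr.
have := dot_Fprime_S k; rewrite {1}/Fprime dotDl.
have := Err_psd k (u k); rewrite /Fval; lra.
Qed.

Lemma sum_rlen_sqr m : (m <= N)%N ->
  mu / 2 * \sum_(k < m) r k ^+ 2 <= Fval 0%N - Fval m.
Proof.
elim: m => [_|m IH mN]; first by rewrite big_ord0 mulr0 subrr.
rewrite big_ord_recr /= mulrDr.
have := IH (ltnW mN); have := descent m mN; lra.
Qed.

Lemma objective_fin k : (k <= N)%N -> objective f g (x k) = (Fval k)%:E.
Proof. by move=> kN; rewrite /objective -{1}(fineK (g_fin _ kN)) -EFinD. Qed.

Lemma inf_objective_le : fine (ereal_inf (range (objective f g))) <= Fval N.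
Proof.
have leN : (ereal_inf (range (objective f g)) <= (Fval N)%:E)%E.
  by rewrite -objective_fin //; apply: ereal_inf_lbound; exists (x N).
(* A finite lower bound and the finite value at [x N] make the infimum real, so [fine] preserves
   it. *)
have [m mle] := F_bounded.
have lem : (m%:E <= ereal_inf (range (objective f g)))%E.
  by apply: le_ereal_inf_tmp => _ [y _ <-]; exact: mle.
rewrite -lee_fin fineK // fin_real //.
by rewrite (lt_le_trans (ltNyr _) lem) (le_lt_trans leN (ltry _)).
Qed.

Lemma sum_rlen_le_C0 : \sum_(k < N) r k ^+ 2 <= C0 f g mu (x 0%N) ^+ 2.
Proof.
have S := sum_rlen_sqr N (leqnn N).
have S0 : 0 <= \sum_(k < N) r k ^+ 2 by apply: sumr_ge0 => k _; exact: sqr_ge0.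
have le : \sum_(k < N) r k ^+ 2 <= 2 * (fine (objective f g (x 0%N))
    - fine (ereal_inf (range (objective f g)))) / mu.
  rewrite ler_pdivlMr // objective_fin //=.
  have := inf_objective_le; lra.
(* The radicand of [C0] dominates a sum of squares, hence squaring undoes the root. *)
by rewrite /C0 sqr_sqrtr //; exact: le_trans le.
Qed.

(** Cauchy-Schwarz against the all-ones vector of length [N]. *)
Lemma sum_rlen_le : \sum_(k < N) r k <= Num.sqrt N%:R * C0 f g mu (x 0%N).
Proof.
rewrite -(@ler_pXn2r _ 2) ?nnegrE ?mulr_ge0 ?sqrtr_ge0 //; last first.
  by apply: sumr_ge0 => k _; exact: rlen_ge0.
rewrite exprMn sqr_sqrtr ?ler0n //.
have := sqr_dot_le (const_mx 1 : 'cV[R]_N) (\col_k r k).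
rewrite !dotE; under eq_bigr do rewrite !mxE mul1r.
under [X in _ <= X * _]eq_bigr do rewrite !mxE mul1r.
under [X in _ <= _ * X]eq_bigr do rewrite !mxE -expr2.
rewrite sumr_const card_ord => /le_trans; apply.
by rewrite ler_wpM2l ?ler0n // sum_rlen_le_C0.
Qed.

(** * Trace of [G] and the total gain *)

(** The sum of [rprev] is that of [r] shifted by one: it starts with 0 and omits the last length. *)
Lemma sum_lam_le m : \sum_(k < m) lam LH x k <= 2 * LH * \sum_(k < m) r k.
Proof.
rewrite -mulrA (mulrCA 2) /lam big_split /= -!mulr_sumr -mulrDr.
rewrite ler_wpM2l ?(ltW LH_gt0) // mulr_natl mulr2n lerD2r.
case: m => [|m]; first by rewrite !big_ord0.
by rewrite big_ord_recl /= add0r big_ord_recr /= lerDl rlen_ge0.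
Qed.

Lemma mxtrace_Gmx m :
  \tr (G m) = n%:R * L + n%:R * \sum_(k < m) lam LH x k - \sum_(k < m) gain k.
Proof.
elim: m => [|m IH].
  by rewrite !big_ord0 mulr0 addr0 subr0 /= mxtrace_scalar mulr_natl.
rewrite !big_ord_recr /= mxtrace_SR1 ?trmx_Jmx ?Gtilde_sym //.
rewrite -/(Gtilde f L LH x m) -/(Err m) -/(gain m) /Gtilde raddfD /=.
by rewrite mxtrace_scalar IH -(mulr_natl (lam _ _ _)); ring.
Qed.

(** For [m > 0], SR1 keeps [G m] above the preceding averaged Hessian, which is itself positive
    semidefinite. *)
Lemma mxtrace_Gmx_ge0 m : 0 <= \tr (G m).
Proof.
case: m => [|m]; first by rewrite mxtrace_scalar mulrn_wge0 // ltW.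
have := mxtrace_psd_ge0 _
  (SR1_psd _ _ (u m) (trmx_Jmx m) (Gtilde_sym m) (Err_psd m)).
rewrite raddfB /= -[SR1 _ _ _]/(G m.+1).
have := mxtrace_psd_ge0 _ (Jmx_psd m); lra.
Qed.

Lemma sum_gain_le : \sum_(k < N) gain k <=
  n%:R * L + 2 * n%:R * LH * (Num.sqrt N%:R * C0 f g mu (x 0%N)).
Proof.
have := mxtrace_Gmx_ge0 N; rewrite mxtrace_Gmx subr_ge0 => /le_trans; apply.
rewrite lerD2l (mulrC 2) -!mulrA ler_wpM2l ?ler0n //.
apply: le_trans (sum_lam_le N) _; rewrite -mulrA ler_wpM2l // ler_wpM2l ?(ltW LH_gt0) //.
exact: sum_rlen_le.
Qed.

(** * Contraction of [F'] and the resulting rate *)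

Lemma gain_ge0 k : 0 <= gain k.
Proof. by rewrite mulr_ge0 ?sqr_ge0 // invr_ge0; exact: Err_psd. Qed.

Lemma Fprime_sqr_gain k :
  enorm (F' k.+1) ^+ 2 = gain k * dot (u k) (Err k *m u k).
Proof.
rewrite Fprime_S enormN /gain.
(* If [Err k *m u k = 0] both sides vanish; otherwise the denominator of [gain] is positive and
   cancels. *)
have [E0|E0] := eqVneq (Err k *m u k) 0.
  by rewrite E0 !dot0r mulr0 enorm_sqr dot0r.
have := psd_mulmx_neq0 _ _ (Err_sym k) (Err_psd k) E0.
by move=> q0; rewrite mulrAC mulVf ?mul1r // gt_eqF.
Qed.

Lemma Fprime_step k : (k < N)%N ->
  enorm (F' k.+1) ^+ 2 <= gain k / mu * enorm (F' k) ^+ 2.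
Proof.
move=> kN; rewrite Fprime_sqr_gain -mulrA ler_wpM2l ?gain_ge0 //.
rewrite ler_pdivlMl //.
have := subdiff_monotone _ _ _ _ _ (g_fin _ (ltnW kN)) (g_fin _ kN)
  (vseq_subdiff k (ltnW kN)) (vseq_subdiff k.+1 kN).
have := strongly_convex_grad_mono f mu (x k) (x k.+1) f_diff2 f_sconvex.
rewrite -/(u k) -/(r k) (dotBl (grad f _)) (dotBl (v k.+1)).
have := dot_Fprime_S k; rewrite {1}/Fprime dotDl.
have := dot_le (F' k) (- u k); rewrite enormN dotNr {1}/Fprime dotDl -/(r k).
set a := enorm (F' k); set q := dot _ (Err k *m _) => h1 h2 h3 h4.
(* Monotonicity of the subgradients of [g] and strong monotonicity of [grad f] bound
   [- q - dot (F' k) (u k)] below by [mu * r k ^+ 2]; Cauchy-Schwarz was applied to [- u k]. *)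
have qle : q <= a * r k - mu * r k ^+ 2 by lra.
(* With [s = mu * r k], the bound [a * s - s ^+ 2 <= a ^+ 2] holds because the difference is
   [(a - s) ^+ 2 + a * s]. *)
have := ler_wpM2l (ltW mu_gt0) qle; have := sqr_ge0 (a - mu * r k).
have : 0 <= a * (mu * r k) by rewrite !mulr_ge0 ?rlen_ge0 ?enorm_ge0 ?(ltW mu_gt0).
lra.
Qed.

Lemma Fprime_prod m : (m <= N)%N ->
  enorm (F' m) ^+ 2 <= \prod_(k < m) (gain k / mu) * enorm (F' 0%N) ^+ 2.
Proof.
elim: m => [_|m IH mN]; first by rewrite big_ord0 mul1r.
rewrite big_ord_recr /=; apply: le_trans (Fprime_step m mN) _.
rewrite (mulrC (\prod_(_ < _) _)) -(mulrA (gain m / mu)) ler_wpM2l ?IH ?(ltnW mN) //.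
by rewrite divr_ge0 ?gain_ge0 // ltW.
Qed.

Lemma Crate_ge0 : 0 <= Crate f g mu L LH (x 0%N).
Proof.
by rewrite /Crate divr_ge0 ?addr_ge0 ?mulr_ge0 ?sqrtr_ge0 ?ler0n ?(ltW L_gt0)
  ?(ltW LH_gt0) ?(ltW mu_gt0).
Qed.

Lemma mean_gain_le : (0 < N)%N ->
  (\sum_(k < N) gain k / mu) / N%:R <= Crate f g mu L LH (x 0%N) / Num.sqrt N%:R.
Proof.
move=> N0; set q := Num.sqrt N%:R.
have NE : N%:R = q ^+ 2 :> R by rewrite sqr_sqrtr ?ler0n.
(* Since [q >= 1], the term [n * L] is at most [n * L * q]; the whole gain sum is then at most
   [mu * Crate * q]. *)
have q1 : 1 <= q by rewrite -[leLHS]sqrtr1 ler_wsqrtr // ler1n.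
have q0 : 0 < q by lra.
rewrite NE ler_pdivrMr ?exprn_gt0 // expr2 mulrA divfK ?gt_eqF //.
rewrite -mulr_suml /Crate mulrAC ler_pM2r ?invr_gt0 //.
apply: le_trans sum_gain_le _; rewrite -/q [leRHS]mulrDl [leLHS]addrC; apply: lerD.
  by rewrite (mulrC q) mulrA.
by rewrite ler_peMr // mulr_ge0 ?ler0n // ltW.
Qed.

Lemma prod_gain_le : (0 < N)%N -> \prod_(k < N) (gain k / mu) <=
  (Crate f g mu L LH (x 0%N) / Num.sqrt N%:R) ^+ N.
Proof.
move=> N0; have c0 k : 0 <= gain k / mu by rewrite divr_ge0 ?gain_ge0 // ltW.
have [le _] := @leif_AGM R _ predT (fun k : 'I_N => gain k / mu) (fun k _ => c0 k).
rewrite cardT size_enum_ord in le; apply: le_trans le _.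
rewrite lerXn2r ?nnegrE ?mean_gain_le //.
  by rewrite divr_ge0 ?sumr_ge0.
by rewrite divr_ge0 ?Crate_ge0 ?sqrtr_ge0.
Qed.

Lemma Fprime_rate : enorm (F' N) <=
  (Crate f g mu L LH (x 0%N) / (N%:R `^ (1 / 2))) `^ (N%:R / 2)
    * enorm (F' 0%N).
Proof.
(* At [N = 0] the exponent is 0 and the power is 1 whatever its base, so both sides agree. *)
have [N0|N0] := posnP N; first by rewrite N0 mul0r powRr0 mul1r.
(* Squaring turns the real exponent [N / 2] into the natural power [N] delivered by AM-GM. *)
rewrite -(@ler_pXn2r _ 2) ?nnegrE ?mulr_ge0 ?enorm_ge0 ?powR_ge0 //.
rewrite exprMn -[X in _ <= X * _]powR_mulrn ?powR_ge0 // -powRrM.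
rewrite divfK ?pnatr_eq0 // div1r powR12_sqrt ?ler0n //.
rewrite powR_mulrn; last exact: divr_ge0 Crate_ge0 (sqrtr_ge0 _).
apply: le_trans (Fprime_prod N (leqnn N)) _.
by rewrite ler_wpM2r ?sqr_ge0 // prod_gain_le.
Qed.

End Algorithm.

Theorem theorem3p1 (R : realType) (n : nat) (f : 'cV[R]_n -> R)
    (g : 'cV[R]_n -> \bar R) (mu L LH : R)
    (mu_gt0 : 0 < mu) (L_gt0 : 0 < L) (LH_gt0 : 0 < LH)
    (g_proper : proper_fun g) (g_lsc : lower_semicontinuous g)
    (g_convex : econvex g)
    (f_diff2 : twice_differentiable f) (f_sconvex : strongly_convex mu f)
    (f_grad : lipschitz_grad L f) (f_hess : lipschitz_hess LH f)
    (F_bounded : bounded_below (objective f g))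
    (x0 v0 : 'cV[R]_n) (v0_subgrad : subdiff g x0 v0)
    (N : nat) (x : nat -> 'cV[R]_n) (x_init : x 0%N = x0)
    (x_run : cubic_SR1_PQN f g L LH x v0 N) :
  enorm (Fprime f L LH x v0 N) <=
    (Crate f g mu L LH x0 / (N%:R `^ (1 / 2))) `^ (N%:R / 2)
      * enorm (Fprime f L LH x v0 0%N).
Proof.
have [run _] := x_run; rewrite -x_init in v0_subgrad *.
exact: Fprime_rate.
Qed.
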